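(* Let $n\ge 1$ and let $\mathcal{S}\subset\mathbb{C}^{n\times n}\times\mathbb{C}^{n\times n}$ be the open subset formed by all pairs $(A,B)$ such that $A$ has no eigenvalues on the closed negative real axis $\mathbb{R}_0^-=(-\infty,0]$ and $B$ is arbitrary. Let $f:\mathcal{S}\to\mathbb{C}^{n\times n}$ be given by $f(A,B):=A^B=e^{\log(A)B}$. Then for every $(A,B)\in\mathcal{S}$ the Fréchet derivative of $f$ at $(A,B)$ is given, for all $E,F\in\mathbb{C}^{n\times n}$, by $$L_f(A,B;E,F)=L_{\exp}\big(\log(A)\,B;\ \log(A)F+L_{\log}(A;E)\,B\big).$$
   Context: $e^X=\exp(X)$ is the matrix exponential. For $A\in\mathbb{C}^{n\times n}$ with no eigenvalues on $\mathbb{R}_0^-=(-\infty,0]$, $\log(A)$ denotes the principal logarithm, i.e. the unique solution $X$ of $e^X=A$ all of whose eigenvalues lie in the open strip $\{z\in\mathbb{C}:-\pi<\operatorname{Im} z<\pi\}$. The matrix-matrix exponentiation is $A^B:=e^{\log(A)B}$. For a map $f$ of two matrix variables, the Fréchet derivative of $f$ at $(X,Y)$ is the linear operator $(E,F)\mapsto L_f(X,Y;E,F)$ from $\mathbb{C}^{n\times n}\times\mathbb{C}^{n\times n}$ to $\mathbb{C}^{n\times n}$ such that $$\lim_{(E,F)\to(0,0)}\frac{\|f(X+E,Y+F)-f(X,Y)-L_f(X,Y;E,F)\|}{\|(E,F)\|}=0.$$ For a map $\phi$ of one matrix variable ($\phi=\exp$ or $\phi=\log$, the latter on the open set of matrices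 with no eigenvalues on $\mathbb{R}_0^-$), $L_\phi(X;E)$ denotes the Fréchet derivative of $\phi$ at $X$ applied to the direction $E\in\mathbb{C}^{n\times n}$. *)

(* Defs.v *)
From HB Require Import structures.
From mathcomp Require Import all_boot all_order all_algebra.
From mathcomp Require Import all_classical all_reals all_analysis.
From mathcomp.real_closed Require Import complex.

Set Implicit Arguments.
Unset Strict Implicit.
Unset Printing Implicit Defensive.

Import Order.TTheory GRing.Theory Num.Theory.
Import numFieldNormedType.Exports.

Local Open Scope classical_set_scope.
Local Open Scope ring_scope.
Local Open Scope complex_scope.

(* R[i] as a normed space over itself, its norm being the complex modulus. The
   library does this for abstract numeric fields; the concrete R[i] needs its
   own copies of the structures of R[i]^o. *)
#[non_forgetful_inheritance]
HB.instance Definition _ (R : realType) :=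
  PseudoPointedMetric.copy R[i] R[i]^o.
#[non_forgetful_inheritance]
HB.instance Definition _ (R : realType) := GRing.ComAlgebra.copy R[i] R[i]^o.
#[non_forgetful_inheritance]
HB.instance Definition _ (R : realType) := Vector.copy R[i] R[i]^o.
#[non_forgetful_inheritance]
HB.instance Definition _ (R : realType) := NormedModule.copy R[i] R[i]^o.

Section MatrixFunctions.
Context {R : realType} {n : nat}.

(* Matrices over R[i] carry the entrywise maximum norm of the library, and
   pairs of matrices the maximum of the two norms; in finite dimension this
   choice affects neither limits nor Frechet derivatives. *)
Implicit Types A B X : 'M[R[i]]_n.+1.

Definition expm X : 'M[R[i]]_n.+1 :=
  lim (series (fun k => (k`!%:R : R[i])^-1 *: X ^+ k) @ \oo).

(* In the order of R[i], [a <= 0] holds iff a is real and nonpositive. *)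
Definition no_nonpos_eigenvalue A : Prop :=
  forall a : R[i], eigenvalue A a -> ~~ (a <= 0).

Definition principal_log_of A X : Prop :=
  expm X = A /\
  forall z : R[i], eigenvalue X z -> - pi < complex.Im z < pi.

(* Meaningful when no_nonpos_eigenvalue A, in which case the solution exists
   and is unique; an unspecified matrix if there is no solution. *)
Definition logm A : 'M[R[i]]_n.+1 := get [set X | principal_log_of A X].

Definition mxpow_dom : set ('M[R[i]]_n.+1 * 'M[R[i]]_n.+1) :=
  [set AB | no_nonpos_eigenvalue AB.1].

Definition mxpow (AB : 'M[R[i]]_n.+1 * 'M[R[i]]_n.+1) : 'M[R[i]]_n.+1 :=
  expm (logm AB.1 *m AB.2).

End MatrixFunctions.

(* Main.v *)
Require Import Defs.
From HB Require Import structures.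
From mathcomp Require Import all_boot all_order all_algebra.
From mathcomp Require Import all_classical all_reals all_analysis.
From mathcomp.real_closed Require Import complex.
From mathcomp Require Import ring lra.

Set Implicit Arguments.
Unset Strict Implicit.
Unset Printing Implicit Defensive.

Import Order.TTheory GRing.Theory Num.Theory.
Import numFieldNormedType.Exports.

Local Open Scope classical_set_scope.
Local Open Scope ring_scope.
Local Open Scope complex_scope.

(* Let [ddexp Y X Z] be the off-diagonal block of the exponential of the block
   triangular matrix [X, 0; Z, Y]. It is linear in [Z], and
   [ddexp Y X (Y - X) = exp Y - exp X], so a Lipschitz bound on exp makes exp
   differentiable at [X] with differential [ddexp X X].
   If [X] and [Y] have their spectra in the strip |Im z| < pi then [ddexp Y X] is
   injective: its kernel is stable under left multiplication by [Y] and right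
   multiplication by [X], so it would contain a common eigenvector [Z], with
   [Y Z = y Z] and [Z X = x Z], on which [ddexp Y X] acts as the nonzero scalar
   (e^y - e^x) / (y - x), or e^x when y = x. This yields
   - uniqueness of the principal logarithm;
   - its existence, by induction on the dimension, since the off-diagonal block
     of the logarithm of a block triangular matrix solves [ddexp X' x C = c];
   - by a Newton iteration, a local right inverse of exp that stays close to
     [log A], hence coincides with log by uniqueness. So log is continuous, and
     differentiable with differential the inverse of [ddexp (log A) (log A)].
   The formula is then the chain rule. *)

(** * Bounds for the entrywise maximum norm *)

Section MatrixNorm.
Context {K : numFieldType}.

Lemma norm_mx_entry m n (M : 'M[K]_(m, n)) i j : `|M i j| <= `|M|.
Proof.
rewrite -[`|M|]/(mx_norm M) mx_normE -num_abs_le //.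
apply/bigmax_geP; right; exists (i, j) => //=.
by rewrite num_abs_le /=.
Qed.

Lemma norm_mx_le m n (M : 'M[K]_(m, n)) c :
  0 <= c -> (forall i j, `|M i j| <= c) -> `|M| <= c.
Proof.
move=> c0 Mc; have [/eqP|/mx_norm_neq0 [ij]] := eqVneq (mx_norm M) 0.
  by move=> /eqP M0; rewrite /Num.norm /= M0.
by rewrite [leLHS]/Num.norm /= => ->.
Qed.

(** An entry of the product is a sum of [n] terms, so the maximum norm is submultiplicative only up
    to the factor [n]; hence the recurring quantity [n.+1%:R * |X|]. *)
Lemma norm_mulmx m n p (A : 'M[K]_(m, n)) (B : 'M[K]_(n, p)) :
  `|A *m B| <= n%:R * `|A| * `|B|.
Proof.
apply: norm_mx_le => [|i j]; first by rewrite !mulr_ge0.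
rewrite mxE; apply: le_trans (ler_norm_sum _ _ _) _.
rewrite -mulrA mulr_natl -[X in _ *+ X]card_ord -sumr_const.
by apply: ler_sum => k _; rewrite normrM ler_pM ?norm_mx_entry.
Qed.

Lemma norm_scalar_mx1 n : `|1%:M : 'M[K]_n| <= 1.
Proof.
by apply: norm_mx_le => // i j; rewrite mxE; case: (_ == _);
  rewrite ?normr1 ?normr0.
Qed.

Lemma norm_expmx n (X : 'M[K]_n.+1) k : `|X ^+ k| <= (n.+1%:R * `|X|) ^+ k.
Proof.
elim: k => [|k IH]; first by rewrite !expr0; exact: norm_scalar_mx1.
rewrite !exprS; apply: le_trans (norm_mulmx _ _) _.
by rewrite ler_wpM2l ?mulr_ge0.
Qed.

(** Induction on [k] by splitting off one factor. The bound contains the derivative of [r ^+ k.+1],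
    so division by [k.+1]! leaves the term of index [k] of the exponential series of [r]. *)
Lemma norm_expmxB n (X Y : 'M[K]_n.+1) r k :
  n.+1%:R * `|X| <= r -> n.+1%:R * `|Y| <= r ->
  `|X ^+ k.+1 - Y ^+ k.+1| <= k.+1%:R * r ^+ k * (n.+1%:R * `|X - Y|).
Proof.
move=> Xr Yr; have r0 : 0 <= r by apply: le_trans Xr; rewrite mulr_ge0.
have powr (Z : 'M[K]_n.+1) j : n.+1%:R * `|Z| <= r -> `|Z ^+ j| <= r ^+ j.
  move=> Zr; apply: le_trans (norm_expmx _ _) _.
  by rewrite lerXn2r ?nnegrE ?mulr_ge0.
elim: k => [|k IH]; first by rewrite !expr1 expr0 !mul1r ler_peMl ?ler1n.
have -> : X ^+ k.+2 - Y ^+ k.+2 =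
    X * (X ^+ k.+1 - Y ^+ k.+1) + (X - Y) * Y ^+ k.+1.
  by rewrite mulrBr mulrBl -!exprS addrA subrK.
apply: le_trans (ler_normD _ _) _.
rewrite [in leRHS]mulrSr [X in _ <= X * _]mulrDl mul1r mulrDl lerD //.
  apply: le_trans (norm_mulmx _ _) _.
  rewrite [leRHS](_ : _ = r * (k.+1%:R * r ^+ k * (n.+1%:R * `|X - Y|))).
    by apply: ler_pM; rewrite ?mulr_ge0.
  by rewrite exprS; ring.
apply: le_trans (norm_mulmx _ _) _.
by rewrite mulrC ler_pM ?mulr_ge0 ?powr.
Qed.

Lemma mx_linear_bounded m n (W : normedModType K)
    (f : {linear 'M[K]_(m, n) -> W}) :
  exists2 c, 0 < c & forall M, `|f M| <= c * `|M|.
Proof.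
(* The summand 1 keeps the constant positive even when [f] vanishes. *)
exists (1 + \sum_i \sum_j `|f (delta_mx i j)|).
  by rewrite ltr_pwDl // sumr_ge0 // => i _; rewrite sumr_ge0.
move=> M; apply: (@le_trans _ _ ((\sum_i \sum_j `|f (delta_mx i j)|) * `|M|));
  last by rewrite ler_wpM2r // lerDr.
rewrite {1}(matrix_sum_delta M) linear_sum mulr_suml.
apply: le_trans (ler_norm_sum _ _ _) _; apply: ler_sum => i _.
rewrite linear_sum mulr_suml.
apply: le_trans (ler_norm_sum _ _ _) _; apply: ler_sum => j _.
by rewrite linearZ normrZ mulrC ler_wpM2l ?norm_mx_entry.
Qed.

Lemma mx_linear_continuous m n (W : normedModType K)
    (f : {linear 'M[K]_(m, n) -> W}) : continuous f.
Proof.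
have [c c0 fc] := mx_linear_bounded f.
apply: bounded_linear_continuous; apply/linear_boundedP.
exists c; split; first exact: gtr0_real.
by move=> d cd x; apply: le_trans (fc x) _; rewrite ler_wpM2r // ltW.
Qed.

Lemma cvg_mx_linear m n (W : normedModType K)
    (f : {linear 'M[K]_(m, n) -> W}) (u : nat -> 'M[K]_(m, n))
    (L : 'M[K]_(m, n)) :
  u @ \oo --> L -> (fun k => f (u k)) @ \oo --> f L.
Proof. by move=> uL; apply: continuous_cvg uL; exact: mx_linear_continuous. Qed.

Lemma cvg_mulmxl m n p (A : 'M[K]_(m, n)) (u : nat -> 'M[K]_(n, p))
    (L : 'M[K]_(n, p)) :
  u @ \oo --> L -> (fun k => A *m u k) @ \oo --> A *m L.
Proof. exact: (@cvg_mx_linear _ _ _ (mulmx A)). Qed.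

Lemma cvg_mulmxr m n p (A : 'M[K]_(n, p)) (u : nat -> 'M[K]_(m, n))
    (L : 'M[K]_(m, n)) :
  u @ \oo --> L -> (fun k => u k *m A) @ \oo --> L *m A.
Proof. exact: (@cvg_mx_linear _ _ _ (mulmxr A)). Qed.

Lemma lim_norm_le (V : normedModType K) (u : nat -> V) L (c : K) :
  u @ \oo --> L -> (forall k, `|u k| <= c) -> `|L| <= c.
Proof.
move=> uL uc; apply/ler_addgt0Pl => e e0.
have [k Lk] : exists k, `|L - u k| <= e.
  by move/cvgrPdist_le: uL => /(_ e e0)/filter_ex.
by rewrite -(subrK (u k) L); apply: le_trans (ler_normD _ _) _; rewrite lerD.
Qed.

End MatrixNorm.

(** * Convergence of series of complex matrices *)

Section ComplexSeries.
Context {R : realType}.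

Lemma normc_real (x : R) : `|x%:C| = `|x|%:C :> R[i].
Proof. by rewrite normc_def /= expr0n /= addr0 sqrtr_sqr. Qed.

Lemma normc_i : `|'i| = 1 :> R[i].
Proof. by rewrite normc_def /= expr0n expr1n /= add0r sqrtr1. Qed.

Lemma normc_le_ReIm (z : R[i]) : `|z| <= (`|complex.Re z| + `|complex.Im z|)%:C.
Proof.
rewrite {1}(complexE z) rmorphD /= -!normc_real.
apply: le_trans (ler_normD _ _) _.
by rewrite lerD2l normrM normc_i mul1r.
Qed.

Lemma normc_ge_Im (z : R[i]) : `|complex.Im z|%:C <= `|z|.
Proof.
by have := normc_ge_Re (z * 'i); rewrite ReiNIm normrN normrM normc_i mulr1.
Qed.

Lemma ge0_complexE (z : R[i]) : 0 <= z -> z = (complex.Re z)%:C.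
Proof. by move=> z0; rewrite RRe_real // ger0_real. Qed.

Lemma ReD (y z : R[i]) : complex.Re (y + z) = complex.Re y + complex.Re z.
Proof. by case: y z => [a b] [c d]. Qed.

Lemma ImD (y z : R[i]) : complex.Im (y + z) = complex.Im y + complex.Im z.
Proof. by case: y z => [a b] [c d]. Qed.

Lemma cvg_mx_ReIm m n (u : nat -> 'M[R[i]]_(m, n)) (L : 'M[R[i]]_(m, n)) :
  (forall i j, (fun k => complex.Re (u k i j)) @ \oo --> complex.Re (L i j)) ->
  (forall i j, (fun k => complex.Im (u k i j)) @ \oo --> complex.Im (L i j)) ->
  u @ \oo --> L.
Proof.
move=> uRe uIm; apply/cvgrPdist_le => e e0.
(* A positive [e] of [R[i]] is real; half of it is spent on each of the real and imaginary parts. *)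
have e20 : 0 < complex.Re e / 2.
  by rewrite divr_gt0 //; move: e0; rewrite ltcE => /andP[].
have near_ij ij : \forall k \near \oo,
    `|complex.Re (L ij.1 ij.2) - complex.Re (u k ij.1 ij.2)| <= complex.Re e / 2 /\
    `|complex.Im (L ij.1 ij.2) - complex.Im (u k ij.1 ij.2)| <= complex.Re e / 2.
  near=> k; split; near: k.
    by have /cvgrPdist_le /(_ _ e20) := uRe ij.1 ij.2.
  by have /cvgrPdist_le /(_ _ e20) := uIm ij.1 ij.2.
apply: filterS (filter_forall _ near_ij) => k Lk.
apply: norm_mx_le => [|i j]; first exact: ltW.
have [LkRe LkIm] := Lk (i, j).
rewrite !mxE (ge0_complexE (ltW e0)); apply: le_trans (normc_le_ReIm _) _.
rewrite lecR [leRHS]splitr lerD //.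
  by case: (L i j) (u k i j) LkRe LkIm => [a b] [c d].
by case: (L i j) (u k i j) LkRe LkIm => [a b] [c d].
Unshelve. all: by end_near. Qed.

(** Comparison with [b] makes the real and imaginary parts of each entry absolutely convergent real
    series; the limit matrix is assembled from their sums. *)
Lemma dominated_series_cvg m n (u : nat -> 'M[R[i]]_(m, n)) (b : nat -> R) :
  cvgn (series b) -> (forall k, `|u k| <= (b k)%:C) -> cvgn (series u).
Proof.
move=> bcvg ub.
have dom (h : R[i] -> R) i j : (forall z, `|h z|%:C <= `|z|) ->
    cvgn (series (fun k => h (u k i j))).
  move=> hz; apply: normed_cvg; apply: series_le_cvg bcvg => // k.
  - exact: normr_ge0.
  - by rewrite -lecR; apply: (le_trans (normr_ge0 (u k))).
  rewrite /= -lecR; apply: le_trans (hz _) _; apply: le_trans (ub k).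
  exact: norm_mx_entry.
pose L : 'M[R[i]]_(m, n) := \matrix_(i, j)
  (limn (series (fun k => complex.Re (u k i j))) +i*
   limn (series (fun k => complex.Im (u k i j)))).
apply: (@cvgP _ _ L); apply: cvg_mx_ReIm => i j; rewrite mxE /=.
  under eq_fun do rewrite summxE (big_morph _ ReD (erefl _)).
  by apply: dom => z; exact: normc_ge_Re.
under eq_fun do rewrite summxE (big_morph _ ImD (erefl _)).
by apply: dom => z; exact: normc_ge_Im.
Qed.

End ComplexSeries.

(** * The matrix exponential: convergence, Lipschitz bound, intertwining *)

Section Expm.
Context {R : realType}.

Definition expm_coeff n (X : 'M[R[i]]_n.+1) k := (k`!%:R : R[i])^-1 *: X ^+ k.

Lemma norm_expm_coeff n (X : 'M[R[i]]_n.+1) (r : R) k :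
  n.+1%:R * `|X| <= r%:C -> `|expm_coeff X k| <= (exp_coeff r k)%:C.
Proof.
move=> Xr; rewrite normrZ normfV normr_nat exp_coeffE rmorphM fmorphV rmorph_nat.
rewrite ler_wpM2l ?invr_ge0 //; apply: le_trans (norm_expmx _ _) _.
by rewrite rmorphXn lerXn2r ?nnegrE ?mulr_ge0 //;
  apply: le_trans Xr; rewrite mulr_ge0.
Qed.

Lemma expm_cvg n (X : 'M[R[i]]_n.+1) :
  series (expm_coeff X) @ \oo --> expm X.
Proof.
apply: (@dominated_series_cvg _ _ _ _
  (exp_coeff (complex.Re (n.+1%:R * `|X|)))).
  exact: is_cvg_series_exp_coeff.
by move=> k; apply: norm_expm_coeff; rewrite -ge0_complexE // mulr_ge0.
Qed.

Lemma series_exp_coeff_le (r : R) k :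
  0 <= r -> series (exp_coeff r) k <= expR r.
Proof.
move=> r0; apply: nondecreasing_cvgn_le; last exact: is_cvg_series_exp_coeff.
by apply: nondecreasing_series => i _ _; exact: exp_coeff_ge0.
Qed.

Lemma expm_lipschitz n (X Y : 'M[R[i]]_n.+1) (r : R) :
  n.+1%:R * `|X| <= r%:C -> n.+1%:R * `|Y| <= r%:C ->
  `|expm X - expm Y| <= (expR r)%:C * (n.+1%:R * `|X - Y|).
Proof.
move=> Xr Yr; have r0 : 0 <= r.
  by rewrite -lecR; apply: le_trans Xr; rewrite mulr_ge0.
apply: (@lim_norm_le _ _ (fun k => series (expm_coeff X) k - series (expm_coeff Y) k)).
  by apply: cvgB; exact: expm_cvg.
case=> [|k].
  by rewrite /series /= !big_geq // subrr normr0 !mulr_ge0 // lecR expR_ge0.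
apply: (@le_trans _ _ ((series (exp_coeff r) k)%:C * (n.+1%:R * `|X - Y|)));
  last by rewrite ler_wpM2r ?mulr_ge0 // lecR series_exp_coeff_le.
(* The terms of index 0 cancel; term [i.+1] of the difference is then compared with term [i] of the
   exponential series of [r]. *)
rewrite /series /= -sumrB big_nat_recl // {1}/expm_coeff {1}/expm_coeff.
rewrite !expr0 subrr add0r rmorph_sum mulr_suml.
apply: le_trans (ler_norm_sum _ _ _) _; apply: ler_sum => i _.
rewrite /expm_coeff -scalerBr normrZ normfV normr_nat.
rewrite ler_pdivrMl ?ltr0n ?fact_gt0 //.
apply: le_trans (norm_expmxB _ Xr Yr) _.
rewrite exp_coeffE rmorphM fmorphV rmorph_nat rmorphXn /= factS natrM.
rewrite [leRHS](_ : _ = i.+1%:R * r%:C ^+ i * (n.+1%:R * `|X - Y|)) //.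
by field; rewrite pnatr_eq0 -lt0n fact_gt0.
Qed.

(** The relation passes to powers, to partial sums and to the limit. With [P] rectangular it governs
    blocks, conjugations and eigenvectors alike. *)
Lemma expm_intertwine n p (A : 'M[R[i]]_n.+1) (B : 'M[R[i]]_p.+1)
    (P : 'M[R[i]]_(n.+1, p.+1)) :
  A *m P = P *m B -> expm A *m P = P *m expm B.
Proof.
move=> AP; have powAP k : A ^+ k *m P = P *m B ^+ k.
  elim: k => [|k IH]; first by rewrite !expr0 mul1mx mulmx1.
  by rewrite exprS exprSr -[A * _]/(A *m _) -[_ * B]/(_ *m B) -mulmxA IH
    mulmxA AP -mulmxA -[B *m _]/(B * _) -exprS exprSr.
apply: (@cvg_unique _ (@norm_hausdorff _ 'M[R[i]]_(n.+1, p.+1))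
  ((fun k => series (expm_coeff A) k *m P) @ \oo)).
  exact/cvg_mulmxr/expm_cvg.
rewrite (_ : (fun k => _) = fun k => P *m series (expm_coeff B) k).
  exact/cvg_mulmxl/expm_cvg.
apply/funext => k; rewrite /series /= mulmx_suml mulmx_sumr.
by apply: eq_bigr => i _; rewrite -scalemxAl powAP scalemxAr.
Qed.

End Expm.

(** * The divided difference [ddexp]: algebra, linearity, Lipschitz bound *)

Section DividedDifference.
Context {R : realType}.

(* [m.+1 + p.+1] is a successor only up to conversion, which defeats
   rewriting with the block lemmas; hence this copy of [expm]. *)
Definition bexpm m p (M : 'M[R[i]]_(m.+1 + p.+1)) : 'M[R[i]]_(m.+1 + p.+1) :=
  @expm R (m + p.+1) M.

Lemma bexpm_intertwinel q m p (A : 'M[R[i]]_q.+1) (M : 'M[R[i]]_(m.+1 + p.+1))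
    (P : 'M[R[i]]_(q.+1, m.+1 + p.+1)) :
  A *m P = P *m M -> expm A *m P = P *m bexpm M.
Proof. exact: expm_intertwine. Qed.

Lemma bexpm_intertwiner q m p (A : 'M[R[i]]_q.+1) (M : 'M[R[i]]_(m.+1 + p.+1))
    (P : 'M[R[i]]_(m.+1 + p.+1, q.+1)) :
  M *m P = P *m A -> bexpm M *m P = P *m expm A.
Proof. exact: expm_intertwine. Qed.

Lemma bexpm_intertwine m p m' p' (M : 'M[R[i]]_(m.+1 + p.+1))
    (M' : 'M[R[i]]_(m'.+1 + p'.+1)) (P : 'M[R[i]]_(m'.+1 + p'.+1, m.+1 + p.+1)) :
  M' *m P = P *m M -> bexpm M' *m P = P *m bexpm M.
Proof. exact: expm_intertwine. Qed.

Lemma bexpm_lipschitz m p (M M' : 'M[R[i]]_(m.+1 + p.+1)) (r : R) :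
  (m + p.+1).+1%:R * `|M| <= r%:C -> (m + p.+1).+1%:R * `|M'| <= r%:C ->
  `|bexpm M - bexpm M'| <= (expR r)%:C * ((m + p.+1).+1%:R * `|M - M'|).
Proof. exact: expm_lipschitz. Qed.

(* The divided difference of exp: for commuting scalars it is
   [z * (e^y - e^x) / (y - x)]. *)
Definition ddexp p m (Y : 'M[R[i]]_p.+1) (X : 'M[R[i]]_m.+1)
    (Z : 'M[R[i]]_(p.+1, m.+1)) : 'M[R[i]]_(p.+1, m.+1) :=
  dlsubmx (bexpm (block_mx X 0 Z Y)).

(** [row_mx 1%:M 0] and [col_mx 0 1%:M] intertwine the block matrix with [X] and with [Y], which
    fixes the top row and the right column of its exponential. *)
Lemma bexpm_lblock p m (Y : 'M[R[i]]_p.+1) (X : 'M[R[i]]_m.+1) Z :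
  bexpm (block_mx X 0 Z Y) = block_mx (expm X) 0 (ddexp Y X Z) (expm Y).
Proof.
have := @bexpm_intertwinel m m p X (block_mx X 0 Z Y) (row_mx 1%:M 0).
have := @bexpm_intertwiner p m p Y (block_mx X 0 Z Y) (col_mx 0 1%:M).
rewrite mul_block_col mul_col_mx mul_row_block mul_mx_row.
rewrite !(mulmx0, mul0mx, mulmx1, mul1mx, addr0, add0r).
move=> /(_ erefl) + /(_ erefl); rewrite /ddexp.
rewrite -(submxK (bexpm (block_mx X 0 Z Y))) block_mxKdl.
rewrite mul_block_col mul_col_mx mul_row_block mul_mx_row.
rewrite !(mulmx0, mul0mx, mulmx1, mul1mx, addr0, add0r).
by move=> /eq_col_mx [-> ->] /eq_row_mx [<- _].
Qed.

(** The block diagonal matrix of [P] and [Q] intertwines the two triangular matrices; compare the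
    lower left blocks of the exponentials. *)
Lemma ddexp_intertwine p m p' m' (Y : 'M[R[i]]_p.+1) (X : 'M[R[i]]_m.+1) Z
    (Y' : 'M[R[i]]_p'.+1) (X' : 'M[R[i]]_m'.+1) Z'
    (Q : 'M[R[i]]_(p'.+1, p.+1)) (P : 'M[R[i]]_(m'.+1, m.+1)) :
  X' *m P = P *m X -> Y' *m Q = Q *m Y -> Z' *m P = Q *m Z ->
  ddexp Y' X' Z' *m P = Q *m ddexp Y X Z.
Proof.
move=> XP YQ ZP.
have := @bexpm_intertwine m p m' p' (block_mx X 0 Z Y) (block_mx X' 0 Z' Y')
  (block_mx P 0 0 Q).
rewrite !bexpm_lblock !mulmx_block.
rewrite !(mulmx0, mul0mx, addr0, add0r) XP YQ ZP => /(_ erefl).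
by case/eq_block_mx.
Qed.

(** The column [col_mx 1%:M (- W)] intertwines the block matrix with [X]; the lower half of the
    exponentiated relation is the claim. *)
Lemma ddexp_sylvester p m (Y : 'M[R[i]]_p.+1) (X : 'M[R[i]]_m.+1) W :
  ddexp Y X (Y *m W - W *m X) = expm Y *m W - W *m expm X.
Proof.
have := @bexpm_intertwiner m m p X
  (block_mx X 0 (Y *m W - W *m X) Y) (col_mx 1%:M (- W)).
rewrite bexpm_lblock !mul_block_col !mul_col_mx.
rewrite !(mulmx0, mul0mx, mulmx1, mul1mx, addr0, add0r, mulmxN, mulNmx).
rewrite addrAC subrr add0r => /(_ erefl) /eq_col_mx [_] /eqP.
by rewrite subr_eq (addrC (- _)) => /eqP.
Qed.

Lemma ddexp_sub m (Y X : 'M[R[i]]_m.+1) :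
  ddexp Y X (Y - X) = expm Y - expm X.
Proof. by have := ddexp_sylvester Y X 1%:M; rewrite !mulmx1 !mul1mx. Qed.

Lemma ddexp_mulmxl p m (Y : 'M[R[i]]_p.+1) (X : 'M[R[i]]_m.+1) Z Q :
  Y *m Q = Q *m Y -> ddexp Y X (Q *m Z) = Q *m ddexp Y X Z.
Proof.
move=> YQ; rewrite -(@ddexp_intertwine _ _ _ _ Y X Z Y X (Q *m Z) Q 1%:M) //;
by rewrite ?mulmx1 ?mul1mx.
Qed.

Lemma ddexp_mulmxr p m (Y : 'M[R[i]]_p.+1) (X : 'M[R[i]]_m.+1) Z P :
  X *m P = P *m X -> ddexp Y X (Z *m P) = ddexp Y X Z *m P.
Proof.
move=> XP; rewrite (@ddexp_intertwine _ _ _ _ Y X (Z *m P) Y X Z 1%:M P) //;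
by rewrite ?mulmx1 ?mul1mx.
Qed.

(** Stack [Z1] over [Z2], with two copies of [Y] on the diagonal. The rows [(1 0)], [(0 1)] and
    [(1 1)] all intertwine [Y] with [YY], and the third is the sum of the first two. *)
Lemma ddexpD p m (Y : 'M[R[i]]_p.+1) (X : 'M[R[i]]_m.+1) :
  {morph ddexp Y X : Z1 Z2 / Z1 + Z2}.
Proof.
move=> Z1 Z2; pose YY := block_mx Y 0 0 Y.
pose D : 'M[R[i]]_(p.+1 + p.+1, m.+1) := @ddexp (p + p.+1) m YY X (col_mx Z1 Z2).
have row_dd (Q : 'M[R[i]]_(p.+1, p.+1 + p.+1)) :
    Y *m Q = Q *m YY -> ddexp Y X (Q *m col_mx Z1 Z2) = Q *m D.
  move=> YQ; rewrite -(@ddexp_intertwine (p + p.+1) m p m YY X (col_mx Z1 Z2)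
    Y X (Q *m col_mx Z1 Z2) Q 1%:M) //;
  by rewrite ?mulmx1 ?mul1mx.
have := row_dd (row_mx 1%:M 1%:M).
have := row_dd (row_mx 0 1%:M).
have := row_dd (row_mx 1%:M 0).
rewrite /YY !mul_row_col !mul_mx_row !add_row_mx.
rewrite !(mulmx0, mul0mx, mulmx1, mul1mx, addr0, add0r).
move=> /(_ erefl) -> /(_ erefl) -> /(_ erefl) ->.
by rewrite -mulmxDl add_row_mx addr0 add0r.
Qed.

Lemma ddexp_is_linear p m (Y : 'M[R[i]]_p.+1) (X : 'M[R[i]]_m.+1) :
  linear (ddexp Y X).
Proof.
move=> a Z1 Z2; rewrite ddexpD; congr (_ + _).
by rewrite -!mul_scalar_mx ddexp_mulmxl // scalar_mxC.
Qed.

HB.instance Definition _ p m (Y : 'M[R[i]]_p.+1) (X : 'M[R[i]]_m.+1) :=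
  GRing.isLinear.Build R[i] 'M[R[i]]_(p.+1, m.+1) 'M[R[i]]_(p.+1, m.+1) _
    (ddexp Y X) (ddexp_is_linear Y X).

Lemma norm_dlsubmx (K : numFieldType) m1 m2 n1 n2 (M : 'M[K]_(m1 + m2, n1 + n2)) :
  `|dlsubmx M| <= `|M|.
Proof. by apply: norm_mx_le => // i j; rewrite !mxE; exact: norm_mx_entry. Qed.

Lemma norm_block_mx_le (K : numFieldType) m1 m2 n1 n2 (A : 'M[K]_(m1, n1))
    (B : 'M[K]_(m1, n2)) (C : 'M[K]_(m2, n1)) (D : 'M[K]_(m2, n2)) c :
  `|A| <= c -> `|B| <= c -> `|C| <= c -> `|D| <= c ->
  `|block_mx A B C D| <= c.
Proof.
move=> Ac Bc Cc Dc; apply: norm_mx_le; first exact: le_trans Ac.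
move=> i j; case: (split_ordP i) => k ->; case: (split_ordP j) => l ->;
  rewrite (block_mxEul, block_mxEur, block_mxEdl, block_mxEdr);
  exact: le_trans (norm_mx_entry _ _ _) _.
Qed.

Lemma ddexp_lipschitz p m (Y : 'M[R[i]]_p.+1) (X : 'M[R[i]]_m.+1) :
  exists2 K, 0 < K & forall d (Y' : 'M[R[i]]_p.+1) (X' : 'M[R[i]]_m.+1) Z,
    d <= 1 -> `|Y' - Y| <= d -> `|X' - X| <= d ->
    `|ddexp Y' X' Z - ddexp Y X Z| <= K * d * `|Z|.
Proof.
set N : R[i] := (m + p.+1).+1%:R; set c := `|X| + `|Y| + 1.
have c_ge0 : 0 <= c by rewrite !addr_ge0.
have N_gt0 : 0 < N by rewrite ltr0n.
set r := complex.Re (N * c).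
have Nc : N * c = r%:C by rewrite {1}(ge0_complexE (mulr_ge0 (ltW N_gt0) c_ge0)).
exists ((expR r)%:C * N); first by rewrite mulr_gt0 // ltcR expR_gt0.
move=> d Y' X' Z d1 Yd Xd; have d0 : 0 <= d := le_trans (normr_ge0 _) Yd.
have [->|Z0] := eqVneq Z 0; first by rewrite !linear0 addr0 !normr0 mulr0.
have nZ : `|Z| != 0 by rewrite normr_eq0.
(* Linearity reduces to [Z1] of norm 1. All blocks involved then have norm at most [c], so a single
   Lipschitz constant of exp serves for every [Z]. *)
pose Z1 := `|Z|^-1 *: Z.
have ZE : Z = `|Z| *: Z1 by rewrite scalerA divff // scale1r.
have nZ1 : `|Z1| = 1 by rewrite normrZ normfV normr_id mulVf.
clearbody Z1.
rewrite [in leLHS]ZE ![ddexp _ _ (_ *: _)]linearZ /= -scalerBr normrZ normr_id.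
rewrite mulrC; apply: ler_wpM2r => //.
have block_le (A : 'M[R[i]]_m.+1) (B : 'M[R[i]]_p.+1) : `|A| <= c -> `|B| <= c ->
    N * `|block_mx A 0 Z1 B| <= r%:C.
  move=> Ac Bc; rewrite -Nc ler_pM2l //; apply: norm_block_mx_le => //.
    by rewrite normr0.
  by rewrite nZ1 lerDr addr_ge0.
rewrite /ddexp -!linearB /=; apply: le_trans (norm_dlsubmx _) _.
apply: le_trans (bexpm_lipschitz (block_le _ _ _ _) (block_le _ _ _ _)) _.
- rewrite -(subrK X X') addrC /c -addrA.
  apply: le_trans (ler_normD _ _) _; rewrite lerD //.
  by apply: le_trans Xd (le_trans d1 _); rewrite lerDr.
- rewrite -(subrK Y Y') addrC /c (addrC `|X|) -addrA.
  apply: le_trans (ler_normD _ _) _; rewrite lerD //.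
  by apply: le_trans Yd (le_trans d1 _); rewrite lerDr.
- by rewrite /c -addrA lerDl addr_ge0.
- by rewrite /c (addrC `|X|) -addrA lerDl addr_ge0.
rewrite -mulrA ler_wpM2l ?lecR ?expR_ge0 // ler_wpM2l //.
rewrite opp_block_mx add_block_mx !subrr.
by apply: norm_block_mx_le; rewrite ?normr0.
Qed.

End DividedDifference.

(** * The scalar exponential and its bijectivity on the strip *)

Section ComplexExponential.

(** The partial sum for [a + b] covers the triangle [j + k < n] by the binomial formula; what
    remains of the square is the corner [n <= j + k]. *)
Lemma exp_series_mul_subD (K : numFieldType) (a b : K) n :
  (\sum_(0 <= j < n) a ^+ j / j`!%:R) * (\sum_(0 <= k < n) b ^+ k / k`!%:R) -
  \sum_(0 <= l < n) (a + b) ^+ l / l`!%:R =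
  \sum_(0 <= k < n) \sum_(n - k <= j < n) (a ^+ j / j`!%:R) * (b ^+ k / k`!%:R).
Proof.
have -> : \sum_(0 <= l < n) (a + b) ^+ l / l`!%:R =
    \sum_(0 <= k < n) \sum_(0 <= j < n - k)
      (a ^+ j / j`!%:R) * (b ^+ k / k`!%:R).
  elim: n => [|n IH]; first by rewrite !big_geq.
  rewrite big_nat_recr //= IH [RHS]big_nat_recr //= subSnn big_nat1.
  (* Each row gains one term; together these form the diagonal [j + k = n], the binomial expansion
     of the new term on the left. *)
  under [in RHS]eq_big_nat => k /andP[_ kn].
    rewrite subSn ?(ltnW kn) // big_nat_recr //=; over.
  rewrite big_split /= -addrA; congr (_ + _).
  rewrite exprDn mulr_suml -(big_mkord xpredT
    (fun k => (a ^+ (n - k) * b ^+ k *+ 'C(n, k)) / n`!%:R)).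
  rewrite big_nat_recr //=; congr (_ + _); last first.
    by rewrite subnn binn !expr0 fact0 mulr1n divr1 !mul1r.
  rewrite !big_nat; apply: eq_bigr => k /andP[_ kn].
  rewrite -[in LHS]mulr_natr -(bin_fact (ltnW kn)) !natrM.
  have := fact_gt0 k; have := fact_gt0 (n - k).
  have : (0 < 'C(n, k))%N by rewrite bin_gt0 ltnW.
  rewrite -!(ltr0n K) => /gt_eqF/negbT ? /gt_eqF/negbT ? /gt_eqF/negbT ?.
  by field; apply/and3P.
rewrite big_distrlr exchange_big /= -sumrB !big_nat.
apply: eq_bigr => k /andP[_ kn].
by rewrite (@big_cat_nat _ _ _ (n - k)%N) ?leq_subr //= addrAC subrr add0r.
Qed.

Context {R : realType}.

(** Euler's formula is taken as the definition because it exhibits modulus and argument;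
    [expm_scalar] links it to the series. *)
Definition cexp (z : R[i]) : R[i] :=
  (expR (complex.Re z))%:C * (cos (complex.Im z) +i* sin (complex.Im z)).

Lemma series_expi (y : R) n :
  \sum_(0 <= k < n) (y%:C * 'i) ^+ k / k`!%:R =
  (series (cos_coeff y) n) +i* (series (sin_coeff y) n) :> R[i].
Proof.
rewrite /series /=; elim: n => [|n IH]; first by rewrite !big_geq.
rewrite !big_nat_recr //= IH.
have -> : (y%:C * 'i) ^+ n / n`!%:R = (cos_coeff y n +i* sin_coeff y n) :> R[i].
  rewrite /cos_coeff /sin_coeff /= exprMn -rmorphXn.
  have sgnC m : (-1) ^+ m = ((-1) ^+ m)%:C :> R[i].
    by rewrite rmorphXn rmorphN1.
  have -> : ('i ^+ n : R[i]) =
      ((~~ odd n)%:R * (-1) ^+ n./2) +i* ((odd n)%:R * (-1) ^+ n.-1./2).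
    rewrite -{1}(odd_double_half n) exprD -muln2 mulnC exprM sqr_i.
    case: (boolP (odd n)) => on /=; rewrite ?expr1 ?expr0 !mul1r mul0r.
      have -> : n.-1./2 = n./2.
        by rewrite -{1}(odd_double_half n) on /= doubleK.
      by rewrite sgnC; simpc.
    by rewrite sgnC.
  rewrite -(rmorph_nat (real_complex R)) -fmorphV; simpc.
  by congr (_ +i* _); rewrite (mulrC (y ^+ n)).
by simpc.
Qed.

(** For [z = x + iy], the partial sum differs from the product of those of [e^x] and [e^(iy)] by the
    corner [d]. Its modulus is at most the corner for [|x|] and [|y|], which tends to
    [e^|x| e^|y| - e^(|x| + |y|) = 0]. *)
Lemma cvg_series_cexp (z : R[i]) (S := fun n =>
    \sum_(0 <= k < n) z ^+ k / k`!%:R) :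
  (fun n => complex.Re (S n)) @ \oo --> complex.Re (cexp z) /\
  (fun n => complex.Im (S n)) @ \oo --> complex.Im (cexp z).
Proof.
set x := complex.Re z; set y := complex.Im z.
have zE : z = x%:C + y%:C * 'i by rewrite (mulrC y%:C) -complexE.
pose d (K : numFieldType) (a b : K) n := \sum_(0 <= k < n)
  \sum_(n - k <= j < n) (a ^+ j / j`!%:R) * (b ^+ k / k`!%:R).
have SE n : S n = (series (exp_coeff x) n)%:C *
    (series (cos_coeff y) n +i* series (sin_coeff y) n) - d _ x%:C (y%:C * 'i) n.
  have -> : (series (exp_coeff x) n)%:C = \sum_(0 <= k < n) x%:C ^+ k / k`!%:R.
    rewrite /series /= rmorph_sum; apply: eq_bigr => k _.
    by rewrite /exp_coeff /= rmorphM fmorphV rmorphXn rmorph_nat.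
  by rewrite /d -exp_series_mul_subD -zE series_expi subKr.
have d0 : d R `|x| `|y| @ \oo --> 0.
  have -> : d R `|x| `|y| = (fun n => series (exp_coeff `|x|) n *
      series (exp_coeff `|y|) n - series (exp_coeff (`|x| + `|y|)) n).
    by apply/funext => n; rewrite /d -exp_series_mul_subD.
  rewrite -(subrr (expR (`|x| + `|y|))) {1}expRD.
  by apply: cvgB; [apply: cvgM|]; exact: is_cvg_series_exp_coeff.
have dn n : `|d _ x%:C (y%:C * 'i) n| <= (d R `|x| `|y| n)%:C.
  rewrite /d rmorph_sum; apply: le_trans (ler_norm_sum _ _ _) _.
  apply: ler_sum => k _; rewrite rmorph_sum.
  apply: le_trans (ler_norm_sum _ _ _) _; apply: ler_sum => j _.
  rewrite !normrM !normfV !normrX !normr_nat normrM normc_i mulr1 !normc_real.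
  by rewrite !rmorphM /= !fmorphV !rmorphXn !rmorph_nat.
have dRe : (fun n => complex.Re (d _ x%:C (y%:C * 'i) n)) @ \oo --> 0.
  apply: norm_cvg0; apply: (squeeze_cvgr _ (cvg_cst _) d0); near=> n.
  by rewrite normr_ge0 /= -lecR; apply: le_trans (normc_ge_Re _) (dn n).
have dIm : (fun n => complex.Im (d _ x%:C (y%:C * 'i) n)) @ \oo --> 0.
  apply: norm_cvg0; apply: (squeeze_cvgr _ (cvg_cst _) d0); near=> n.
  by rewrite normr_ge0 /= -lecR; apply: le_trans (normc_ge_Im _) (dn n).
have cvge : series (exp_coeff x) @ \oo --> expR x by exact: is_cvg_series_exp_coeff.
have cvgc : series (cos_coeff y) @ \oo --> cos y.
  by rewrite cos.unlock; exact: is_cvg_series_cos_coeff.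
have cvgs : series (sin_coeff y) @ \oo --> sin y.
  by rewrite sin.unlock; exact: is_cvg_series_sin_coeff.
split.
  have -> : (fun n => complex.Re (S n)) = (fun n => series (exp_coeff x) n *
      series (cos_coeff y) n - complex.Re (d _ x%:C (y%:C * 'i) n)).
    by apply/funext => n; rewrite SE; case: (d _ _ _ n) => u v; simpc.
  rewrite (_ : complex.Re (cexp z) = expR x * cos y - 0); last first.
    by rewrite /cexp subr0; simpc.
  by apply: cvgB => //; apply: cvgM.
have -> : (fun n => complex.Im (S n)) = (fun n => series (exp_coeff x) n *
    series (sin_coeff y) n - complex.Im (d _ x%:C (y%:C * 'i) n)).
  by apply/funext => n; rewrite SE; case: (d _ _ _ n) => u v; simpc.
rewrite (_ : complex.Im (cexp z) = expR x * sin y - 0); last first.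
  by rewrite /cexp subr0; simpc.
by apply: cvgB => //; apply: cvgM.
Unshelve. all: by end_near. Qed.

Lemma expm_scalar n (z : R[i]) : expm (z%:M : 'M[R[i]]_n.+1) = (cexp z)%:M.
Proof.
apply: (@cvg_unique _ (@norm_hausdorff _ 'M[R[i]]_n.+1)
  (series (expm_coeff (z%:M : 'M[R[i]]_n.+1)) @ \oo)); first exact: expm_cvg.
have -> : series (expm_coeff (z%:M : 'M[R[i]]_n.+1)) =
    (fun k => (\sum_(0 <= l < k) z ^+ l / l`!%:R)%:M).
  apply/funext => k; rewrite /series /= raddf_sum; apply: eq_bigr => l _.
  by rewrite /expm_coeff -rmorphXn /= scale_scalar_mx mulrC.
have [cRe cIm] := cvg_series_cexp z.
apply: cvg_mx_ReIm => i j; under eq_fun do rewrite mxE; rewrite mxE.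
  by case: (i == j) => //; exact: cvg_cst.
by case: (i == j) => //; exact: cvg_cst.
Qed.

Lemma cexpDr (z : R[i]) (h : R) : cexp (z + h%:C) = (expR h)%:C * cexp z.
Proof.
by rewrite /cexp ReD ImD /= addr0 expRD rmorphM mulrA (mulrC (expR h)%:C).
Qed.

Lemma norm_cexp (z : R[i]) : `|cexp z| = (expR (complex.Re z))%:C.
Proof.
rewrite /cexp normrM normc_real (ger0_norm (expR_ge0 _)) normc_def /= cos2Dsin2.
by rewrite sqrtr1 mulr1.
Qed.

(** By the half-angle formula [sin (t / 2) = 0], while sine is positive on the open interval from 0
    to [pi], which contains [t / 2] or [- (t / 2)] unless [t = 0]. *)
Lemma cos_eq1 (t : R) : - (pi *+ 2) < t < pi *+ 2 -> cos t = 1 -> t = 0.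
Proof.
move=> /andP[tl tr] ct.
have s2 : sin (t / 2) = 0.
  have := cos_mulr2n (t / 2); rewrite mulr2n -splitr ct cos2sin2 => c2.
  by apply/eqP; rewrite -sqrf_eq0; apply/eqP; lra.
have [t0|t0|//] := ltgtP t 0.
  have := @sin_gt0_pi R (- (t / 2)); rewrite sinN s2 oppr0 ltxx => H.
  by have /H : 0 < - (t / 2) < pi by apply/andP; split; lra.
have := @sin_gt0_pi R (t / 2); rewrite s2 ltxx => H.
by have /H : 0 < t / 2 < pi by apply/andP; split; lra.
Qed.

Definition in_strip (z : R[i]) := - pi < complex.Im z < pi.

(** Equal moduli give equal real parts. The cosine of the difference of the imaginary parts is then
    1, and the strip keeps this difference strictly within [2 pi] of 0. *)
Lemma cexp_inj (y z : R[i]) : in_strip y -> in_strip z -> cexp y = cexp z -> y = z.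
Proof.
rewrite /in_strip => /andP[yl yr] /andP[zl zr] yz.
have Reyz : complex.Re y = complex.Re z.
  by apply: expR_inj; apply: complexI; rewrite -!norm_cexp yz.
move: yz; rewrite /cexp Reyz => /mulfI; rewrite -(rmorph0 (real_complex R)).
rewrite (inj_eq (@complexI R)) expR_eq0 => /(_ isT) [cyz syz].
have : complex.Im y - complex.Im z = 0.
  apply: cos_eq1; first by rewrite -mulr_natr; apply/andP; split; lra.
  by rewrite cosB cyz syz -!expr2 cos2Dsin2.
move/subr0_eq; case: y z Reyz {cyz syz yl yr zl zr} => [a b] [c d] /=.
by move=> -> ->.
Qed.

(** Polar form: the imaginary part of [z] is [acos (Re a / |a|)], negated when [Im a] is
    negative. *)
Lemma cexp_surj (a : R[i]) : ~~ (a <= 0) -> exists2 z, in_strip z & cexp z = a.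
Proof.
move=> a0; set r := complex.Re `|a|.
have ar : `|a| = r%:C by exact: ge0_complexE.
have r_gt0 : 0 < r.
  rewrite -ltcR -ar normr_gt0; apply: contraNneq a0 => ->; exact: lexx.
have r0 : r != 0 by rewrite gt_eqF.
set x := complex.Re a / r; set y := complex.Im a / r.
have xy1 : x ^+ 2 + y ^+ 2 = 1.
  rewrite !expr_div_n -mulrDl; have := add_Re2_Im2 a; rewrite ar -rmorphXn.
  by move=> /complexI ->; rewrite divff // expf_neq0.
have x1 : -1 <= x <= 1.
  by rewrite -ler_norml -(@expr_le1 _ 2) // real_normK ?num_real // -xy1 lerDl sqr_ge0.
have sy : Num.sqrt (1 - x ^+ 2) = `|y| by rewrite -xy1 addrAC subrr add0r sqrtr_sqr.
(* [x = -1] would force [y = 0] and make [a] a negative real; excluding it keeps [acos x] strictly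
   below [pi]. *)
have xN1 : -1 < x.
  rewrite lt_neqAle (andP x1).1 andbT; apply: contraNneq a0 => xm1.
  have y0 : y = 0.
    by apply/eqP; rewrite -sqrf_eq0; apply/eqP; move: xy1; rewrite -xm1; lra.
  rewrite lecE /=; move/eqP: y0; rewrite mulf_eq0 invr_eq0 (negbTE r0) orbF.
  move=> /eqP ->; rewrite eqxx /=.
  have -> : complex.Re a = x * r by rewrite divfK.
  by rewrite -xm1 mulN1r oppr_le0 ltW.
have [theta /andP[tl tr] [ct st]] : exists2 theta, - pi < theta < pi &
    cos theta = x /\ sin theta = y.
  have acos_pi : acos x < pi by apply: acos_ltpi; rewrite xN1 (andP x1).2.
  have acos0 : 0 <= acos x by exact: acos_ge0.
  have acosx : cos (acos x) = x by rewrite acosK // in_itv.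
  have [y0|y0] := leP 0 y.
    exists (acos x); last by rewrite sin_acos // sy ger0_norm.
    by rewrite acos_pi andbT; apply: lt_le_trans acos0; rewrite oppr_lt0 pi_gt0.
  exists (- acos x); last by rewrite cosN sinN sin_acos // sy ltr0_norm // opprK.
  rewrite ltrN2 acos_pi /=; apply: le_lt_trans (pi_gt0 R).
  by rewrite oppr_le0.
exists (ln r +i* theta); first by rewrite /in_strip /= tl.
rewrite /cexp /= lnK ?posrE // ct st; apply/eqP; rewrite eq_complex; simpc.
by rewrite /x /y !(mulrC r) !divfK // !eqxx.
Qed.

End ComplexExponential.

(** * Eigenvalues and eigenvectors in stable sets *)

Section Eigen.
Context {F : fieldType}.

Lemma eigenvalueE n (A : 'M[F]_n) a : eigenvalue A a = (A - a%:M \notin unitmx).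
Proof. by rewrite /eigenvalue kermx_eq0 row_free_unit. Qed.

Lemma eigenvalue_tr n (A : 'M[F]_n) a : eigenvalue A^T a = eigenvalue A a.
Proof. by rewrite !eigenvalueE -unitmx_tr linearB /= trmxK tr_scalar_mx. Qed.

Lemma eigenvalue_mulmxl n p (A : 'M[F]_n) a (Z : 'M[F]_(n, p)) :
  Z != 0 -> A *m Z = a *: Z -> eigenvalue A a.
Proof.
move=> Z0 AZ; rewrite eigenvalueE; apply: contra Z0 => /mulKmx ZK.
rewrite -(ZK _ Z).
by rewrite mulmxBl AZ mul_scalar_mx subrr mulmx0.
Qed.

Lemma eigenvalue_mulmxr n p (A : 'M[F]_n) a (Z : 'M[F]_(p, n)) :
  Z != 0 -> Z *m A = a *: Z -> eigenvalue A a.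
Proof.
move=> Z0 AZ; rewrite -eigenvalue_tr (@eigenvalue_mulmxl _ p _ _ Z^T) //.
  by rewrite -trmx0 (inj_eq trmx_inj).
by rewrite -trmx_mul AZ linearZ.
Qed.

Lemma eigenvalue_lblock n1 n2 (A : 'M[F]_n1) (B : 'M[F]_(n2, n1)) (D : 'M[F]_n2) a :
  eigenvalue (block_mx A 0 B D) a = eigenvalue A a || eigenvalue D a.
Proof.
rewrite !eigenvalueE -negb_and (scalar_mx_block n1 n2 a) opp_block_mx add_block_mx.
by rewrite oppr0 !addr0 !unitmxE det_lblock unitrM.
Qed.

Lemma eigenvalue_conj n (S A B : 'M[F]_n) a :
  S \in unitmx -> S *m A = B *m S -> eigenvalue A a = eigenvalue B a.
Proof.
move=> Su SA; have : S *m (A - a%:M) = (B - a%:M) *m S.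
  by rewrite mulmxBr mulmxBl SA scalar_mxC.
move=> /(congr1 (fun M => M \in unitmx)); rewrite !unitmx_mul Su andbT /=.
by rewrite !eigenvalueE => ->.
Qed.

End Eigen.

Section CommonEigenvector.
Context {F : closedFieldType}.

(** Apply the linear factors of the characteristic polynomial to [Z] one after the other. By
    Cayley-Hamilton the result is eventually 0, and the last nonzero matrix on the way, still in
    [P], is the eigenvector. *)
Lemma stable_eigenvectorl n p (A : 'M[F]_n.+1) (P : 'M[F]_(n.+1, p) -> Prop) :
  (forall Z a, P Z -> P (A *m Z - a *: Z)) ->
  forall Z, Z != 0 -> P Z ->
  exists2 Z', Z' != 0 & P Z' /\ exists a, A *m Z' = a *: Z'.
Proof.
move=> PA Z; have [s sE] := closed_field_poly_normal (char_poly A).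
have : horner_mx A (\prod_(a <- s) ('X - a%:P)) *m Z = 0.
  have := Cayley_Hamilton A; rewrite sE (monicP (char_poly_monic A)) scale1r.
  by move=> ->; rewrite mul0mx.
elim: s Z {sE} => [|a s IH] Z.
  by rewrite big_nil rmorph1 mul1mx => ->; rewrite eqxx.
rewrite big_cons mulrC rmorphM /= -mulmxA rmorphB /= horner_mx_X horner_mx_C.
rewrite mulmxBl mul_scalar_mx => sZ Z0 PZ.
have [AZ|AZ] := eqVneq (A *m Z - a *: Z) 0; last exact: (IH _ sZ AZ (PA _ _ PZ)).
by exists Z => //; split=> //; exists a; apply/subr0_eq.
Qed.

Lemma stable_eigenvectorr n p (A : 'M[F]_n.+1) (P : 'M[F]_(p, n.+1) -> Prop) :
  (forall Z a, P Z -> P (Z *m A - a *: Z)) ->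
  forall Z, Z != 0 -> P Z ->
  exists2 Z', Z' != 0 & P Z' /\ exists a, Z' *m A = a *: Z'.
Proof.
move=> PA Z Z0 PZ.
have [|||Z' Z'0 [PZ' [a AZ']]] :=
  @stable_eigenvectorl n p A^T (fun W => P W^T) _ Z^T.
- by move=> W a PW; rewrite linearB linearZ /= trmx_mul trmxK; apply: PA.
- by rewrite -trmx0 (inj_eq trmx_inj).
- by rewrite trmxK.
exists Z'^T; first by rewrite -trmx0 (inj_eq trmx_inj).
by split=> //; exists a; rewrite -[A]trmxK -trmx_mul AZ' linearZ.
Qed.

End CommonEigenvector.

(** * Injectivity of [ddexp] and of exp on the strip *)

Section Injectivity.
Context {R : realType}.

Lemma expm_mulmxl_eigen n p (A : 'M[R[i]]_n.+1) a (Z : 'M[R[i]]_(n.+1, p.+1)) :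
  A *m Z = a *: Z -> expm A *m Z = cexp a *: Z.
Proof.
rewrite -mul_mx_scalar => /expm_intertwine ->.
by rewrite expm_scalar mul_mx_scalar.
Qed.

Lemma expm_mulmxr_eigen n p (A : 'M[R[i]]_n.+1) a (Z : 'M[R[i]]_(p.+1, n.+1)) :
  Z *m A = a *: Z -> Z *m expm A = cexp a *: Z.
Proof.
rewrite -mul_scalar_mx => /esym/expm_intertwine <-.
by rewrite expm_scalar mul_scalar_mx.
Qed.

Lemma ddexp_eigen p m (Y : 'M[R[i]]_p.+1) (X : 'M[R[i]]_m.+1) Z y x :
  Y *m Z = y *: Z -> Z *m X = x *: Z ->
  (y - x) *: ddexp Y X Z = (cexp y - cexp x) *: Z.
Proof.
move=> YZ ZX; rewrite -linearZ /= scalerBl -YZ -ZX ddexp_sylvester.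
by rewrite (expm_mulmxl_eigen YZ) (expm_mulmxr_eigen ZX) scalerBl.
Qed.

(* Perturbing [Y] to [Y + h] makes the two eigenvalues distinct, and
   [|exp (y + h) - exp y| >= h |exp y|] survives the limit [h -> 0]. *)
Lemma ddexp_eigen_neq0 p m (Y : 'M[R[i]]_p.+1) (X : 'M[R[i]]_m.+1) Z y :
  Y *m Z = y *: Z -> Z *m X = y *: Z -> Z != 0 -> ddexp Y X Z != 0.
Proof.
move=> YZ ZX Z0; apply/eqP => dd0.
have [K K0 lip] := ddexp_lipschitz Y X.
have Z_gt0 : 0 < `|Z| by rewrite normr_gt0.
(* For the shifted [Y], [ddexp] acts on [Z] as [e^y (e^h - 1) / h]; as it vanishes on [Z] at
   [h = 0], the Lipschitz bound makes this at most [K h] in modulus. *)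
have le_h (h : R) : 0 < h <= 1 -> `|cexp y| <= K * h%:C.
  move=> /andP[h0 h1]; have hC0 : 0 < h%:C :> R[i] by rewrite ltcR.
  have YhZ : (Y + h%:C%:M) *m Z = (y + h%:C) *: Z.
    by rewrite mulmxDl YZ mul_scalar_mx scalerDl.
  have := ddexp_eigen YhZ ZX; rewrite addrAC subrr add0r cexpDr.
  rewrite -[X in _ - X]mul1r -mulrBl => /(congr1 Num.norm); rewrite !normrZ normrM.
  rewrite (gtr0_norm hC0) => ddh.
  have hY : `|(h%:C)%:M : 'M[R[i]]_p.+1| <= h%:C.
    apply: norm_mx_le => [|i j]; first exact: ltW.
    rewrite mxE; case: (i == j); last by rewrite mulr0n normr0 ltW.
    by rewrite mulr1n gtr0_norm.
  have := lip h%:C (Y + h%:C%:M) X Z.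
  rewrite dd0 subr0 subrr normr0 addrAC subrr add0r lecR h1.
  move=> /(_ isT hY (ltW hC0)); rewrite -(ler_pM2l hC0) ddh mulrA.
  rewrite ler_pM2r // => H.
  have eh : h <= expR h - 1 by rewrite lerBrDl expR_ge1Dx.
  rewrite -(ler_pM2l hC0); apply: le_trans H; apply: ler_wpM2r => //.
  rewrite -(rmorph1 (real_complex R)) -rmorphB normc_real lecR ger0_norm //.
  by apply: le_trans eh; exact: ltW.
(* [h <= c / (2 k)], with [c] the modulus of [cexp y] and [k] the real number [K], gives
   [K h <= c / 2 < c]. *)
have [h h01 hK] : exists2 h : R, 0 < h <= 1 & K * h%:C < `|cexp y|.
  have KE := ge0_complexE (ltW K0); set k := complex.Re K in KE.
  have k0 : 0 < k by rewrite -ltcR -KE.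
  rewrite norm_cexp KE; set c := expR _; have c0 : 0 < c := expR_gt0 _.
  exists (Num.min 1 (c / (k + k))).
    by rewrite lt_min ltr01 divr_gt0 ?addr_gt0 //= ge_min lexx.
  rewrite -rmorphM ltcR; apply: (@le_lt_trans _ _ (k * (c / (k + k)))).
    by rewrite ler_pM2l // ge_min lexx orbT.
  by rewrite mulrA ltr_pdivrMr ?addr_gt0 // mulrC ltr_pM2l // ltrDl.
by have := lt_le_trans hK (le_h h h01); rewrite ltxx.
Qed.

Definition strip_spectrum n (X : 'M[R[i]]_n.+1) :=
  forall z, eigenvalue X z -> in_strip z.

Lemma ddexp_eq0 p m (Y : 'M[R[i]]_p.+1) (X : 'M[R[i]]_m.+1) Z :
  strip_spectrum Y -> strip_spectrum X -> ddexp Y X Z = 0 -> Z = 0.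
Proof.
move=> Ys Xs ddZ; apply/eqP; apply/negP => /negP Z0.
have [|Z1 Z10 [ddZ1 [y YZ1]]] := @stable_eigenvectorl _ _ _ Y
    (fun W => ddexp Y X W = 0) _ Z Z0 ddZ.
  by move=> W a ddW; rewrite linearB linearZ /= ddexp_mulmxl // ddW mulmx0 scaler0 subr0.
(* Carrying [Y W = y W] in the predicate makes the new eigenvector common to [Y] and [X]. *)
have [|Z2 Z20 [[ddZ2 YZ2] [x ZX2]]] := @stable_eigenvectorr _ _ _ X
    (fun W => ddexp Y X W = 0 /\ Y *m W = y *: W) _ Z1 Z10 (conj ddZ1 YZ1).
  move=> W a [ddW YW]; split.
    by rewrite linearB linearZ /= ddexp_mulmxr // ddW mul0mx scaler0 subr0.
  by rewrite mulmxBr mulmxA YW -scalemxAl -scalemxAr YW scalerBr !scalerA mulrC.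
have [xy|xy] := eqVneq y x.
  by rewrite -xy in ZX2; have := ddexp_eigen_neq0 YZ2 ZX2 Z20; rewrite ddZ2 eqxx.
have := ddexp_eigen YZ2 ZX2; rewrite ddZ2 scaler0 => /esym/eqP.
rewrite scaler_eq0 (negbTE Z20) orbF subr_eq0 => /eqP /cexp_inj yx.
by move/eqP: xy; apply; apply: yx; [apply: Ys|apply: Xs];
  [apply: eigenvalue_mulmxl YZ2|apply: eigenvalue_mulmxr ZX2].
Qed.

Lemma expm_inj n (Y X : 'M[R[i]]_n.+1) :
  strip_spectrum Y -> strip_spectrum X -> expm Y = expm X -> Y = X.
Proof.
move=> Ys Xs YX; apply/subr0_eq; apply: (ddexp_eq0 Ys Xs).
by rewrite ddexp_sub YX subrr.
Qed.

(** An injective endomorphism of a finite-dimensional space is bijective; [linfun] supplies the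
    inverse as a linear map. *)
Lemma ddexp_bij p m (Y : 'M[R[i]]_p.+1) (X : 'M[R[i]]_m.+1) :
  strip_spectrum Y -> strip_spectrum X ->
  exists2 f : {linear 'M[R[i]]_(p.+1, m.+1) -> 'M[R[i]]_(p.+1, m.+1)},
    cancel (ddexp Y X) f & cancel f (ddexp Y X).
Proof.
move=> Ys Xs; pose g := linfun (ddexp Y X).
have kg : lker g == 0%VS.
  by apply/lker0P => Z1 Z2; rewrite !lfunE /= => /eqP;
    rewrite -subr_eq0 -linearB => /eqP /(ddexp_eq0 Ys Xs) /subr0_eq.
exists (g^-1)%VF => Z.
  by have := lker0_lfunK kg Z; rewrite lfunE.
by have := lker0_lfunVK kg Z; rewrite lfunE.
Qed.

End Injectivity.

(** * Existence of the principal logarithm *)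

Section ExistenceOfLog.

Lemma eigenvalue_scalar (F : fieldType) n (a z : F) :
  eigenvalue (a%:M : 'M[F]_n.+1) z = (z == a).
Proof.
rewrite eigenvalueE -raddfB /= unitmxE det_scalar unitfE expf_eq0 negbK.
by rewrite subr_eq0 eq_sym.
Qed.

(** [row_ebase v] is a basis whose first row is a multiple of a row eigenvector [v]; in this basis
    the first row of [A] is [a] followed by zeros. *)
Lemma block_triangularize (F : closedFieldType) n (A : 'M[F]_(1 + n)) :
  exists2 S, S \in unitmx & exists a c A', S *m A = block_mx a%:M 0 c A' *m S.
Proof.
have [|||v v0 [_ [a va]]] := @stable_eigenvectorr _ n 1 A (fun=> True) _
    (const_mx 1 : 'M[F]_(1, 1 + n)) => //.
  by apply/eqP => /matrixP /(_ 0 0) /eqP; rewrite !mxE oner_eq0.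
exists (row_ebase v); first exact: row_ebase_unit.
set S := row_ebase v.
have Su : S \in unitmx by exact: row_ebase_unit.
have rv : \rank v = 1%N by rewrite rank_rV v0.
have cu : col_ebase v \in unitmx by exact: col_ebase_unit.
have e1 : (row_mx 1%:M 0 : 'M[F]_(1, 1 + n)) *m S = invmx (col_ebase v) *m v.
  apply: (canRL (mulKmx cu)).
  by rewrite -[RHS](mulmx_ebase v) rv pid_mx_row mulmxA.
pose B : 'M[F]_(1 + n) := S *m A *m invmx S.
have e1B : (row_mx 1%:M 0 : 'M[F]_(1, 1 + n)) *m B = a *: row_mx 1%:M 0.
  rewrite /B !mulmxA e1 -(mulmxA _ v) va -scalemxAr -e1 -scalemxAl.
  by rewrite mulmxK.
exists a, (dlsubmx B), (drsubmx B).
rewrite -[LHS](mulmxKV Su) -/B; congr (_ *m _).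
rewrite -[LHS]submxK; move: e1B; rewrite -{1}(submxK B) mul_row_block.
rewrite !mul1mx !mul0mx !addr0 scale_row_mx scaler0 => /eq_row_mx [-> ->].
by rewrite scalemx1.
Qed.

Context {R : realType}.

Lemma principal_log_exists n (A : 'M[R[i]]_n.+1) :
  no_nonpos_eigenvalue A -> exists X, principal_log_of A X.
Proof.
elim: n A => [|n IH] A An.
  have [|z zs za] := @cexp_surj R (A 0 0).
    by apply: An; rewrite {1}[A]mx11_scalar eigenvalue_scalar.
  exists z%:M; split; first by rewrite expm_scalar za -mx11_scalar.
  by move=> w; rewrite eigenvalue_scalar => /eqP ->.
have [S Su [a [c [A' SA]]]] := @block_triangularize _ n.+1 A.
have eigA w : eigenvalue A w = (w == a) || eigenvalue A' w.
  by rewrite (eigenvalue_conj w Su SA) eigenvalue_lblock (@eigenvalue_scalar _ 0).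
have [|X' [eX' sX']] := IH A'.
  by move=> w Aw; apply: An; rewrite eigA Aw orbT.
have [|z zs za] := @cexp_surj R a; first by apply: An; rewrite eigA eqxx.
have zs1 : strip_spectrum (z%:M : 'M[R[i]]_1).
  by move=> w; rewrite eigenvalue_scalar => /eqP ->.
have [f _ fK] := @ddexp_bij _ n 0 X' z%:M sX' zs1.
(* The diagonal blocks are logarithms of [a] and [A'], and [f c] is the preimage of [c] under
   [ddexp], so [L] exponentiates to the triangular form of [A]. *)
pose L : 'M[R[i]]_(1 + n.+1) := block_mx z%:M 0 (f c) X'.
have bL : bexpm (L : 'M[R[i]]_(0.+1 + n.+1)) = block_mx a%:M 0 c A'.
  by rewrite bexpm_lblock fK eX' expm_scalar za.
pose X : 'M[R[i]]_n.+2 := invmx S *m L *m S.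
have SX : S *m X = L *m S by rewrite /X !mulmxA mulmxV // mul1mx.
exists X; split.
  have := @bexpm_intertwiner _ n.+1 0 n X L S (esym SX).
  rewrite bL -SA => /(congr1 (mulmx (invmx S))).
  by rewrite !mulKmx.
move=> w; rewrite (eigenvalue_conj w Su SX) eigenvalue_lblock.
by rewrite (@eigenvalue_scalar _ 0) => /orP[/eqP ->|/sX'].
Qed.

End ExistenceOfLog.

(** * Differentiability criterion, continuity of products and polynomials *)

Section Generalities.
Context {K : numFieldType}.

Lemma is_diff_of_bound (V W : normedModType K) (f : V -> W)
    (df : {linear V -> W}) x : continuous df ->
  (forall e, 0 < e -> \forall h \near (0 : V),
     `|f (h + x) - f x - df h| <= e * `|h|) ->
  differentiable f x /\ 'd f x = df :> (V -> W).
Proof.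
move=> dfc fe.
have fE : f \o shift x = cst (f x) + df +o_ (0 : V) id.
  apply/eqaddoP => e e0; apply: filterS (fe e e0) => h.
  by rewrite /= opprD addrA.
have dE : 'd f x = df :> (V -> W) by exact: diff_unique.
by split=> //; apply/diff_locallyP; rewrite dE.
Qed.

Lemma mulmx_continuous m n p :
  continuous (fun M : 'M[K]_(m, n) * 'M[K]_(n, p) => M.1 *m M.2).
Proof.
move=> [A B]; apply/cvgrPdist_le => e e0 /=.
(* Increments below [d <= 1] change the product by at most [N * d <= e]. The summand [e] of the
   denominator ensures [d <= 1] and covers [N = 0]. *)
pose N : K := n%:R * (`|A| + `|B| + 1); pose d := e / (e + N).
have N0 : 0 <= N by rewrite mulr_ge0 // !addr_ge0.
have eN : 0 < e + N by rewrite ltr_pwDl.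
have d0 : 0 < d by rewrite divr_gt0.
have d1 : d <= 1 by rewrite ler_pdivrMr // mul1r lerDl.
exists ([set A' | `|A - A'| < d], [set B' | `|B - B'| < d]).
  by split=> /=; [have /nbhs_normP : nbhs_ball_ (ball_ Num.norm) A
      [set A' | `|A - A'| < d] by exists d|have /nbhs_normP :
      nbhs_ball_ (ball_ Num.norm) B [set B' | `|B - B'| < d] by exists d].
move=> [A' B'] [/= /ltW Ad /ltW Bd].
have -> : A *m B - A' *m B' = A *m (B - B') + (A - A') *m B - (A - A') *m (B - B').
  by rewrite -addrA -mulmxBr subKr mulmxBr mulmxBl addrA subrK.
have H1 : `|A *m (B - B')| <= n%:R * `|A| * d.
  by apply: le_trans (norm_mulmx _ _) _; rewrite ler_wpM2l ?mulr_ge0.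
have H2 : `|(A - A') *m B| <= n%:R * `|B| * d.
  apply: le_trans (norm_mulmx _ _) _; rewrite mulrAC.
  by rewrite ler_wpM2l ?mulr_ge0.
have H3 : `|(A - A') *m (B - B')| <= n%:R * d.
  apply: le_trans (norm_mulmx _ _) _.
  rewrite ler_pM ?mulr_ge0 // -[leRHS]mulr1 ler_wpM2l //.
  exact: le_trans d1.
apply: le_trans (ler_normB _ _) (le_trans (lerD (ler_normD _ _) (lexx _)) _).
apply: le_trans (lerD (lerD H1 H2) H3) _.
rewrite [leLHS](_ : _ = N * d); last by rewrite /N; ring.
by rewrite mulrA ler_pdivrMr // mulrC ler_wpM2l ?(ltW e0) // lerDr ltW.
Qed.

Lemma horner_mx_continuous n (p : {poly K}) :
  continuous (fun A : 'M[K]_n.+1 => horner_mx A p).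
Proof.
elim/poly_ind: p => [|p c IH].
  have -> : (fun A : 'M[K]_n.+1 => horner_mx A 0) = cst 0.
    by apply/funext => A; rewrite rmorph0.
  exact: cst_continuous.
have -> : (fun A : 'M[K]_n.+1 => horner_mx A (p * 'X + c%:P)) =
    (fun A => horner_mx A p *m A + c%:M).
  by apply/funext => A; rewrite rmorphD rmorphM /= horner_mx_X horner_mx_C.
move=> A; apply: (@cvgD _ _ _ (nbhs A) _ (fun A => horner_mx A p *m A) (cst c%:M));
  last exact: cvg_cst.
exact: (@continuous2_cvg _ _ _ _ (nbhs A) _ (fun B => horner_mx B p) id mulmx
  _ _ (@mulmx_continuous n.+1 n.+1 n.+1 (horner_mx A p, A)) (IH A) cvg_id).
Qed.

Lemma horner_mx_eigen n (A : 'M[K]_n.+1) (p : {poly K}) z (v : 'rV_n.+1) :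
  v *m A = z *: v -> v *m horner_mx A p = p.[z] *: v.
Proof.
move=> vA; elim/poly_ind: p => [|p c IH].
  by rewrite rmorph0 horner0 mulmx0 scale0r.
rewrite rmorphD rmorphM /= horner_mx_X horner_mx_C mulmxDr mulmxA IH.
by rewrite -scalemxAl vA mul_mx_scalar scalerA -scalerDl hornerMXaddC.
Qed.

(** A row eigenvector [v] of [A] satisfies [v p(A) = p(z) v]; take norms and cancel that of [v]. *)
Lemma norm_eigenvalue_horner n (A : 'M[K]_n.+1) (p : {poly K}) z :
  eigenvalue A z -> `|p.[z]| <= n.+1%:R * `|horner_mx A p|.
Proof.
case/eigenvalueP => v vA v0; rewrite -(@ler_pM2l _ `|v|) ?normr_gt0 //.
rewrite mulrC -normrZ -(horner_mx_eigen _ vA).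
by apply: le_trans (norm_mulmx _ _) _; rewrite -mulrA mulrCA.
Qed.

End Generalities.

(** * Semicontinuity of the spectrum *)

Section Spectrum.
Context {R : realType}.

(* If [p] is the characteristic polynomial of [A] then [p] is bounded away
   from 0 off [U], while [p(A')] tends to [p(A) = 0]. *)
Lemma spectrum_near n (A : 'M[R[i]]_n.+1) (U : set R[i]) :
  open U -> (forall z, eigenvalue A z -> U z) ->
  \forall A' \near A, forall z, eigenvalue A' z -> U z.
Proof.
move=> Uo AU; have [s sE] := closed_field_poly_normal (char_poly A).
rewrite (monicP (char_poly_monic A)) scale1r in sE.
have sU a : a \in s -> U a.
  by move=> sa; apply: AU; rewrite eigenvalue_root_char sE root_prod_XsubC.
(* [d] is the product, over the roots [a], of radii of balls around [a] inside [U]; off [U] each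
   factor [|z - a|] is at least its radius. *)
have [d d0 dU] : exists2 d : R[i], 0 < d &
    forall z, ~ U z -> d <= `|(char_poly A).[z]|.
  rewrite {}sE; elim: s sU => [|a s IH] sU.
    by exists 1 => // z _; rewrite big_nil hornerC normr1.
  have [b bs|d d0 ds] := IH; first by apply: sU; rewrite inE bs orbT.
  have /nbhs_normP [e e0 eU] : nbhs a U.
    by apply: open_nbhs_nbhs; split=> //; apply: sU; rewrite inE eqxx.
  exists (e * d); first by rewrite mulr_gt0.
  move=> z Uz; rewrite big_cons hornerM normrM ler_pM ?(ltW e0) ?(ltW d0) ?ds //.
  rewrite !hornerE real_leNgt ?normr_real ?gtr0_real //.
  by apply/negP => ze; apply/Uz/eU; rewrite /= distrC.
have pA : (fun A' : 'M[R[i]]_n.+1 => horner_mx A' (char_poly A) : 'M[R[i]]_n.+1)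
    @ A --> (0 : 'M[R[i]]_n.+1).
  by rewrite -(Cayley_Hamilton A); exact: horner_mx_continuous.
have dn : 0 < d / n.+1%:R by rewrite divr_gt0 // ltr0n.
have pAd := (cvgr0Pnorm_lt _).1 pA _ dn.
apply: filterS (pAd (nbhs_filter A)) => A' pA' z A'z.
apply: contrapT => /dU; apply/negP; rewrite -real_ltNge ?normr_real ?gtr0_real //.
apply: le_lt_trans (norm_eigenvalue_horner (char_poly A) A'z) _.
by rewrite mulrC -ltr_pdivlMr.
Qed.

Lemma near_ReIm (z : R[i]) (e : R) : 0 < e -> \forall w \near z,
  `|complex.Re w - complex.Re z| < e /\ `|complex.Im w - complex.Im z| < e.
Proof.
move=> e0; apply/nbhs_normP; exists e%:C; first by rewrite /= ltcR.
move=> w; rewrite /= distrC => we; rewrite -!ltcR.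
split; apply: le_lt_trans we.
  by apply: le_trans (normc_ge_Re _); rewrite lecR; case: w z => [? ?] [? ?].
by apply: le_trans (normc_ge_Im _); rewrite lecR; case: w z => [? ?] [? ?].
Qed.

Lemma open_in_strip : open [set z : R[i] | in_strip z].
Proof.
rewrite openE => z /andP[zl zr].
have e0 : 0 < Num.min (complex.Im z + pi) (pi - complex.Im z).
  by rewrite lt_min; apply/andP; split; lra.
apply: filterS (near_ReIm z e0) => w [_].
rewrite lt_min !ltr_norml => /andP[/andP[w1 w2] /andP[w3 w4]].
by apply/andP; split; lra.
Qed.

Lemma open_not_nonpos : open [set z : R[i] | ~~ (z <= 0)].
Proof.
rewrite openE => z /=; rewrite lecE negb_and => /orP[z0|].
  have e0 : 0 < `|complex.Im z| by rewrite normr_gt0 eq_sym.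
  apply: filterS (near_ReIm z e0) => w [_ wz]; rewrite /= lecE negb_and.
  apply/orP; left; apply: contraTneq wz => <-.
  by rewrite sub0r normrN ltxx.
rewrite -ltNge => z0; apply: filterS (near_ReIm z z0) => w [+ _].
rewrite ltr_norml /= lecE negb_and => /andP[w1 _].
by apply/orP; right; rewrite -ltNge /=; move: w1 z0; rewrite /=; lra.
Qed.

End Spectrum.

(** * Differentiability of exp and of the principal logarithm *)

Section Differentiability.
Context {R : realType} {n : nat}.
Implicit Types A X Y : 'M[R[i]]_n.+1.

Lemma near0_norm_le (d : R[i]) :
  0 < d -> \forall h \near (0 : 'M[R[i]]_n.+1), `|h| <= d.
Proof.
move=> d0; apply/nbhs_normP; exists d => // h.
by rewrite /= sub0r normrN => /ltW.
Qed.

(** The increment is exactly [ddexp (h + X) X h], within [K |h|^2] of [ddexp X X h] by the Lipschitz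
    bound. *)
Lemma expm_diff X : differentiable (@expm R n) X /\
  'd (@expm R n) X = ddexp X X :> ('M[R[i]]_n.+1 -> 'M[R[i]]_n.+1).
Proof.
have [K K0 lip] := ddexp_lipschitz X X.
apply: is_diff_of_bound; first exact: mx_linear_continuous.
move=> e e0; near=> h.
have eqh : expm (h + X) - expm X = ddexp (h + X) X h.
  by rewrite -ddexp_sub addrK.
rewrite eqh; apply: le_trans (lip `|h| _ _ _ _ _ _) _.
- by near: h; exact: near0_norm_le.
- by rewrite addrK.
- by rewrite subrr normr0.
- rewrite ler_wpM2r // mulrC -ler_pdivlMr //.
  by near: h; apply: near0_norm_le; rewrite divr_gt0.
Unshelve. all: by end_near. Qed.

Lemma expm_continuous : continuous (@expm R n).
Proof. by move=> X; apply: differentiable_continuous; have [] := expm_diff X. Qed.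

(** Prepares the Newton iteration and the derivative of the logarithm: the inverse [f] of
    [ddexp X X] almost inverts [ddexp Y Y'], uniformly for [Y] and [Y'] near [X]. *)
Lemma ddexp_inverse X : strip_spectrum X ->
  exists2 f : {linear 'M[R[i]]_n.+1 -> 'M[R[i]]_n.+1},
    cancel f (ddexp X X) & exists2 C, 0 < C & 
    exists2 K, 0 < K &
    (forall Z, `|f Z| <= C * `|Z|) /\
    forall d Y Y' Z, d <= 1 -> `|Y - X| <= d -> `|Y' - X| <= d ->
      `|Z - f (ddexp Y Y' Z)| <= K * d * `|Z|.
Proof.
move=> Xs; have [f fK Kf] := ddexp_bij Xs Xs.
have [C C0 fC] := mx_linear_bounded f.
have [K K0 lip] := ddexp_lipschitz X X.
exists f => //; exists C => //; exists (C * K); first exact: mulr_gt0.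
split=> // d Y Y' Z d1 Yd Y'd.
rewrite -{1}(fK Z) -linearB; apply: le_trans (fC _) _.
by rewrite -!mulrA ler_pM2l // mulrA distrC lip.
Qed.

(* The iteration Y |-> Y - f (e^Y - A), with f the inverse of the derivative of
   exp at X, contracts a ball around X by the factor 1/2. *)
Lemma expm_locally_onto X e : strip_spectrum X -> 0 < e ->
  \forall A \near expm X, exists2 Y, `|Y - X| <= e & expm Y = A.
Proof.
move=> Xs e0; have [f fK [C C0 [K K0 [fC lip]]]] := ddexp_inverse Xs.
(* The summands [e], [1] and [2 K e] of the denominator give in turn [d <= 1], [d <= e] and
   [K d <= 1/2]. *)
pose d := e / (1 + e + K * e *+ 2).
have Ke0 : 0 < K * e by rewrite mulr_gt0.
have den0 : 0 < 1 + e + K * e *+ 2 by rewrite !addr_gt0 ?mulrn_wgt0.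
have d0 : 0 < d by rewrite divr_gt0.
have d1 : d <= 1.
  by rewrite ler_pdivrMr // mul1r addrAC lerDr ltW // addr_gt0 ?mulrn_wgt0.
have de : d <= e.
  by rewrite ler_pdivrMr // ler_peMr ?(ltW e0) // -addrA lerDl ltW // addr_gt0 ?mulrn_wgt0.
have Kd : K * d <= 2^-1.
  rewrite mulrA ler_pdivrMr // ler_pdivlMl // mulr_natl.
  by rewrite lerDr ltW // addr_gt0.
(* At this distance of [A] from [expm X] the first step has length at most [d / 2], so by
   contraction all iterates stay within [d] of [X]. *)
have dC : 0 < d / 2 / C by rewrite !divr_gt0.
suff : forall A, `|A - expm X| <= d / 2 / C ->
    exists2 Y, `|Y - X| <= e & expm Y = A.
  move=> H; apply/nbhs_normP; exists (d / 2 / C) => // A /= AX.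
  by apply: H; rewrite distrC ltW.
move=> A AX; pose G Y : 'M[R[i]]_n.+1 := Y - f (expm Y - A).
have GB Y Y' : `|Y - X| <= d -> `|Y' - X| <= d -> `|G Y - G Y'| <= 2^-1 * `|Y - Y'|.
  move=> Yd Y'd; have -> : G Y - G Y' = (Y - Y') - f (ddexp Y Y' (Y - Y')).
    have eYY' : expm Y - expm Y' = (expm Y - A) - (expm Y' - A).
      by rewrite opprB addrA subrK.
    by rewrite ddexp_sub eYY' (linearB f) /G !opprD !opprK addrACA.
  by apply: le_trans (lip _ _ _ _ d1 Yd Y'd) _; rewrite ler_wpM2r.
have GX : `|G X - X| <= d / 2.
  rewrite /G addrAC subrr add0r normrN; apply: le_trans (fC _) _.
  by rewrite mulrC -ler_pdivlMr // distrC.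
have [u u0 uS] : exists2 u, u 0%N = X & forall k, u k.+1 = G (u k).
  by exists (fun k => iter k G X).
have ud k : `|u k - X| <= d.
  elim: k => [|k IH]; first by rewrite u0 subrr normr0 ltW.
  rewrite uS -(subrKA (G X)); apply: le_trans (ler_normD _ _) _.
  rewrite [leRHS]splitr lerD //; apply: le_trans (GB _ _ _ _) _ => //.
    by rewrite subrr normr0 ltW.
  by rewrite mulrC ler_pM2r.
have du k : `|u k.+1 - u k| <= (2^-1) ^+ k * (d / 2).
  elim: k => [|k IH]; first by rewrite uS u0 expr0 mul1r.
  rewrite [u k.+2]uS {2}uS.
  apply: le_trans (GB (u k.+1) (u k) (ud _) (ud _)) _.
  by rewrite exprS -mulrA ler_pM2l.
have [L uL] : exists L : 'M[R[i]]_n.+1, u @ \oo --> L.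
  have d2E : d / 2 = (complex.Re (d / 2))%:C.
    by apply: ge0_complexE; rewrite ltW // divr_gt0.
  (* The increments are dominated by a geometric series, and their sums telescope to [u k - X]. *)
  have : cvgn (series (fun k => u k.+1 - u k)).
    apply: (@dominated_series_cvg _ _ _ _ (geometric (complex.Re (d / 2)) 2^-1)).
      by apply: is_cvg_geometric_series; rewrite ger0_norm // invf_lt1 // ltr1n.
    move=> k; apply: le_trans (du k) _; rewrite {1}d2E /geometric.
    by rewrite rmorphM rmorphXn fmorphV rmorph_nat mulrC.
  have -> : series (fun k => u k.+1 - u k) = (fun k => u k - X).
    by apply/funext => k; rewrite /series /= telescope_sumr // u0.
  move=> /cvg_ex [L uL]; exists (L + X).
  have -> : u = (fun k => (u k - X) + X) by apply/funext => k; rewrite subrK.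
  exact: (cvgD uL (cvg_cst X)).
exists L.
  apply: le_trans de; apply: (@lim_norm_le _ _ (fun k => u k - X)); last exact: ud.
  exact: (cvgB uL (cvg_cst X)).
(* The step [u k - u k.+1] tends both to this value and to 0; [f] is injective, having [ddexp X X]
   as a left inverse. *)
have f0 : f (expm L - A) = 0.
  apply: (@cvg_unique _ (@norm_hausdorff _ 'M[R[i]]_n.+1)
    ((fun k => u k - u k.+1) @ \oo)).
    have -> : (fun k => u k - u k.+1) = (fun k => f (expm (u k) - A)).
      by apply/funext => k; rewrite uS /G opprB addrC subrK.
    apply: cvg_mx_linear; apply: cvgB; last exact: cvg_cst.
    by apply: continuous_cvg uL; exact: expm_continuous.
  by rewrite -(subrr L); apply: cvgB => //; rewrite cvg_shiftS.
by apply/subr0_eq; rewrite -(fK (expm L - A)) f0 linear0.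
Qed.

Lemma logmE A X : principal_log_of A X -> logm A = X.
Proof.
move=> [eX Xs]; have [eY Ys] : principal_log_of A (logm A).
  by apply: (@getPex _ [set X | principal_log_of A X]); exists X.
exact: (expm_inj Ys Xs (etrans eY (esym eX))).
Qed.

Lemma logmP A : no_nonpos_eigenvalue A -> principal_log_of A (logm A).
Proof. by move=> /principal_log_exists [X AX]; rewrite (logmE AX). Qed.

(** The preimage of [A'] given by [expm_locally_onto] is close enough to [X] to keep its spectrum in
    the strip, so uniqueness makes it [logm A']. *)
Lemma logm_near A e : no_nonpos_eigenvalue A -> 0 < e ->
  \forall A' \near A, `|logm A' - logm A| <= e /\ expm (logm A') = A'.
Proof.
move=> /logmP; set X := logm A => -[eX Xs] e0.
have /nbhs_normP [d d0 dX] := spectrum_near open_in_strip Xs.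
have ed0 : 0 < e + d by rewrite addr_gt0.
(* A positive number below both [e] and [d]. *)
have d'0 : 0 < e * d / (e + d) by rewrite divr_gt0 // mulr_gt0.
have := expm_locally_onto Xs d'0; rewrite eX; apply: filterS => A' [Y YX eY].
have -> : logm A' = Y.
  apply: logmE; split; first exact: eY.
  apply: (dX Y _); rewrite /= distrC; apply: le_lt_trans YX _.
  by rewrite ltr_pdivrMr // [ltRHS]mulrC ltr_pM2r // ltrDl.
split; last exact: eY.
apply: le_trans YX _.
by rewrite ler_pdivrMr // ler_pM2l // lerDr ltW.
Qed.

Lemma logm_differentiable A :
  no_nonpos_eigenvalue A -> differentiable (@logm R n) A.
Proof.
move=> An; have [eX Xs] := logmP An; set X := logm A in eX Xs.
have [f fK [C C0 [K K0 [fC lip]]]] := ddexp_inverse Xs.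
apply: (proj1 (@is_diff_of_bound _ _ _ _ f _ _ _)).
  exact: mx_linear_continuous.
(* The three summands of [D] give in turn [1 / D <= 1], [K / D <= 1/2] and [2 K C / D <= e]. *)
move=> e e0; pose D := 1 + K *+ 2 + K * C *+ 2 / e.
have K2 : 0 < K *+ 2 by rewrite mulrn_wgt0.
have KC2 : 0 < K * C *+ 2 / e by rewrite divr_gt0 ?mulrn_wgt0 ?mulr_gt0.
have D0 : 0 < D by rewrite !addr_gt0.
have d0 : 0 < D^-1 by rewrite invr_gt0.
have d1 : D^-1 <= 1 by rewrite invf_le1 // /D -addrA lerDl ltW // addr_gt0.
have Kd : K * D^-1 <= 2^-1.
  rewrite ler_pdivrMr // ler_pdivlMl // mulr_natl /D addrAC lerDr.
  by rewrite ltW // addr_gt0.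
have KdC : K * D^-1 * (2 * C) <= e.
  rewrite mulrAC ler_pdivrMr // -ler_pdivrMl //.
  rewrite [leLHS](_ : _ = K * C *+ 2 / e); last by rewrite -mulr_natr; ring.
  by rewrite /D lerDr ltW // addr_gt0.
have := (nbhs0P _ _).1 (logm_near An d0); apply: filterS => h [].
rewrite (addrC A) -/X; set Y := logm (h + A) => Yd eY.
have eh : ddexp Y X (Y - X) = h by rewrite ddexp_sub eY eX addrK.
have Xd : `|X - X| <= D^-1 by rewrite subrr normr0 ltW.
have := lip _ _ _ (Y - X) d1 Yd Xd; rewrite eh => WK.
(* [Y - X] differs from [f h] by at most half its own norm; absorbing that half leaves a bound
   linear in [h], which turns [WK] into the bound [e |h|]. *)
have W2 : `|Y - X| <= 2 * C * `|h|.
  rewrite -mulrA -ler_pdivrMl //.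
  have : `|Y - X| <= 2^-1 * `|Y - X| + C * `|h|.
    rewrite -{1}(subrK (f h) (Y - X)); apply: le_trans (ler_normD _ _) _.
    by rewrite lerD //; apply: le_trans WK _; rewrite ler_wpM2r.
  rewrite -lerBlDl; apply: le_trans.
  by rewrite [leRHS](_ : _ = 2^-1 * `|Y - X|) //; field.
apply: le_trans WK _; apply: le_trans (_ : K / D * (2 * C * `|h|) <= _).
  by rewrite ler_wpM2l // ltW // divr_gt0.
by rewrite mulrA ler_wpM2r.
Qed.

End Differentiability.

(** * Product rule, chain rule and the final formula *)

Lemma is_diff_fst (K : numFieldType) (V W : normedModType K) (p : V * W) :
  is_diff p fst (fst : V * W -> V).
Proof.
have c : continuous (fst : V * W -> V) by move=> x; exact: cvg_fst.
by apply: DiffDef; [exact: linear_differentiable|exact: diff_lin].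
Qed.

Lemma is_diff_snd (K : numFieldType) (V W : normedModType K) (p : V * W) :
  is_diff p snd (snd : V * W -> W).
Proof.
have c : continuous (snd : V * W -> W) by move=> x; exact: cvg_snd.
by apply: DiffDef; [exact: linear_differentiable|exact: diff_lin].
Qed.

Lemma is_diff_mulmx (K : numFieldType) m n p
    (M : 'M[K]_(m, n) * 'M[K]_(n, p)) :
  is_diff M (fun N => N.1 *m N.2)
    (fun N : 'M[K]_(m, n) * 'M[K]_(n, p) => M.1 *m N.2 + N.1 *m M.2).
Proof.
have c := @mulmx_continuous K m n p.
apply: DiffDef; first exact: (differentiable_bilin (f := @mulmx K m n p)).
exact: (diff_bilin (f := @mulmx K m n p)).
Qed.

(** The map factors as [(A, B) |-> (f A, B)] followed by the matrix product, whose differential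
    keeps the order of the factors; [f] will be [logm]. *)
Lemma is_diff_mulmx_fst (K : numFieldType) (V : normedModType K) m n p
    (f : V -> 'M[K]_(m, n)) (A : V) (B : 'M[K]_(n, p)) :
  differentiable f A ->
  is_diff (A, B) (fun AB => f AB.1 *m AB.2)
    (fun EF => f A *m EF.2 + 'd f A EF.1 *m B).
Proof.
move=> df; have dfst := @is_diff_fst _ V 'M[K]_(n, p) (A, B).
have dsnd := @is_diff_snd _ V 'M[K]_(n, p) (A, B).
have dg := is_diff_pair (is_diff_comp dfst (differentiableP df)) dsnd.
exact: (is_diff_comp dg (is_diff_mulmx (f A, B))).
Qed.

Theorem corollary3p1 (R : realType) (n : nat) :
  open (@mxpow_dom R n) /\
  forall A B : 'M[R[i]]_n.+1, mxpow_dom (A, B) ->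
    [/\ differentiable (@expm R n) (logm A *m B),
        differentiable (@logm R n) A,
        differentiable (@mxpow R n) (A, B)
      & forall E F : 'M[R[i]]_n.+1,
          'd (@mxpow R n) (A, B) (E, F) =
          'd (@expm R n) (logm A *m B)
            (logm A *m F + 'd (@logm R n) A E *m B)].
Proof.
split.
  rewrite openE => -[A B] /= An.
  (* A product neighbourhood: only the spectrum of the first component is constrained. *)
  exists ([set A' | no_nonpos_eigenvalue A'], setT); last by move=> [A' B'] [].
  split; last exact: filterT.
  exact: (spectrum_near open_not_nonpos An).
move=> A B An; have dexp := (expm_diff (logm A *m B)).1.
have dlog := logm_differentiable An.
have dg := is_diff_mulmx_fst B dlog.
have [dmx dmxE] := is_diff_comp dg (differentiableP dexp).
split; [exact: dexp|exact: dlog|exact: dmx|].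
by move=> E F; exact: (congr1 (fun f => f (E, F)) dmxE).
Qed.
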